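(* Let $X=\lambda_p(A,\mathbb{Z})$ be a Köthe sequence space, where $A=(a_{j,k})_{j\in\mathbb{Z},k\in\mathbb{N}}$ is a Köthe matrix on $\mathbb{Z}$ and $p\in\{0\}\cup[1,\infty)$. For each $k\in\mathbb{N}$, define $I_k=\{j\in\mathbb{Z}:a_{j,k}\ne0\}$. Let $w=(w_j)_{j\in\mathbb{Z}}$ be a sequence of nonzero scalars such that the bilateral weighted forward shift $$F_w:(x_j)_{j\in\mathbb{Z}}\in X\mapsto(w_{j-1}x_{j-1})_{j\in\mathbb{Z}}\in X$$ is an invertible operator on $X$. Then $F_w$ is uniformly expansive if and only if one of the following properties holds: (A) For each $k\in\mathbb{N}$, there exists $\ell\in\mathbb{N}$ such that $$\lim_{n\to\infty}\Big(\inf_{j\in I_k}\frac{a_{j+n,\ell}\,|w_j\cdots w_{j+n-1}|}{a_{j,k}}\Big)=\infty.$$ (B) For each $k\in\mathbb{N}$, there exists $\ell\in\mathbb{N}$ such that $$\lim_{n\to\infty}\Big(\inf_{j\in I_k}\frac{a_{j-n,\ell}}{a_{j,k}\,|w_{j-n}\cdots w_{j-1}|}\Big)=\infty.$$ (C) For each $k\in\mathbb{N}$, there exists $\ell\in\mathbb{N}$ such that $$\lim_{n\to\infty}\Big(\inf_{j\in I_k\cap\mathbb{N}}\frac{a_{j+n,\ell}\,|w_j\cdots w_{j+n-1}|}{a_{j,k}}\Big)=\infty\quad\text{and}\quad\lim_{n\to\infty}\Big(\inf_{j\in I_k\cap(-\mathbb{N})}\frac{a_{j-n,\ell}}{a_{j,k}\,|w_{j-n}\cdots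 w_{j-1}|}\Big)=\infty.$$
   Context: $\mathbb{K}$ denotes $\mathbb{R}$ or $\mathbb{C}$, $\mathbb{N}=\{1,2,3,\dots\}$, and $-\mathbb{N}$ is the set of negative integers. The infimum of a family indexed by the empty set is $\infty$. An operator on a locally convex space $X$ is a continuous linear map $X\to X$; it is invertible if it has a continuous inverse, and $GL(X)$ is the set of invertible operators. A Köthe matrix on $\mathbb{Z}$ is a family of scalars $A=(a_{j,k})_{j\in\mathbb{Z},k\in\mathbb{N}}$ such that for each $j\in\mathbb{Z}$: $0\le a_{j,1}\le a_{j,2}\le\cdots$, and $a_{j,k}>0$ for some $k$. For $p\in[1,\infty)$, $\lambda_p(A,\mathbb{Z})=\{(x_j)\in\mathbb{K}^{\mathbb{Z}}:\sum_{j}|a_{j,k}x_j|^p<\infty\text{ for all }k\in\mathbb{N}\}$ with seminorms $\|x\|_k=(\sum_{j}|a_{j,k}x_j|^p)^{1/p}$. For $p=0$, $\lambda_0(A,\mathbb{Z})=\{(x_j)\in\mathbb{K}^{\mathbb{Z}}:\lim_{|j|\to\infty}a_{j,k}x_j=0\text{ for all }k\in\mathbb{N}\}$ with seminorms $\|x\|_k=\sup_{j}|a_{j,k}x_j|$. The space carries the Fréchet topology induced by the increasing sequence $(\|\cdot\|_k)_{k\in\mathbb{N}}$. Known fact (convention $0/0=1$): $F_w$ is an operator on $\lambda_p(A,\mathbb{Z})$ iff for each $k$ there is $\ell$ such that $a_{j+1,k}=0$ whenever $a_{j,\ell}=0$, and $\sup_j\frac{a_{j+1,k}|w_j|}{a_{j,\ell}}<\infty$;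 in this case it is invertible iff for each $k$ there is $\ell$ such that $a_{j,k}=0$ whenever $a_{j+1,\ell}=0$, and $\sup_j\frac{a_{j,k}}{a_{j+1,\ell}|w_j|}<\infty$. Uniform expansivity, expressed with the seminorms $(\|\cdot\|_k)_{k\in\mathbb{N}}$: let $S_{\|\cdot\|_k}=\{x\in X:\|x\|_k=1\}$. $T\in GL(X)$ is uniformly expansive if for each $k\in\mathbb{N}$ there exists $\ell\in\mathbb{N}$ such that one can write $S_{\|\cdot\|_k}=S_k^+\cup S_k^-$, where $\|T^nx\|_\ell\to\infty$ uniformly on $S_k^+$ as $n\to\infty$ and $\|T^{-n}x\|_\ell\to\infty$ uniformly on $S_k^-$ as $n\to\infty$. *)

(* Defs.v *)
From HB Require Import structures.
From mathcomp Require Import all_boot all_order all_algebra complex.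
From mathcomp Require Import all_classical all_reals all_analysis.

Set Implicit Arguments.
Unset Strict Implicit.
Unset Printing Implicit Defensive.

Import Order.TTheory GRing.Theory Num.Theory.
Import numFieldNormedType.Exports.

Local Open Scope classical_set_scope.
Local Open Scope ring_scope.

Variant scalar_kind := Reals | Complexes.

Definition scalars (R : realType) (s : scalar_kind) : numFieldType :=
  match s with Reals => R | Complexes => R[i] end.

(* The norm of a numFieldType takes its values in that same type, hence this
   R-valued absolute value. *)
Definition modulus (R : realType) (s : scalar_kind) : scalars R s -> R :=
  match s with
  | Reals => fun x : R => `|x|
  | Complexes => fun x : R[i] => ComplexField.Normc.normc x
  end.

Section modulus_theory.
Variables (R : realType) (s : scalar_kind).
Implicit Types x y : scalars R s.

Lemma modulus_ge0 x : 0 <= modulus x.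
Proof. by case: s x => [x|[a b]] /=; [exact: normr_ge0|exact: sqrtr_ge0]. Qed.

Lemma modulus0 : modulus (0 : scalars R s) = 0.
Proof. by case: s => /=; [exact: normr0|exact: ComplexField.Normc.normc0]. Qed.

Lemma modulusM x y : modulus (x * y) = modulus x * modulus y.
Proof.
by case: s x y => x y /=; [exact: normrM|exact: ComplexField.Normc.normcM].
Qed.

Lemma modulusD x y : modulus (x + y) <= modulus x + modulus y.
Proof.
by case: s x y => x y /=; [exact: ler_normD|exact: le_normcD].
Qed.

Lemma modulusN x : modulus (- x) = modulus x.
Proof. by case: s x => x /=; [exact: normrN|exact: normcN]. Qed.

Lemma modulus_convex x : 0 <= x -> x <= 1 ->
  modulus x + modulus (1 - x) = 1.
Proof.
case: s x => x /= x0 x1.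
  by rewrite !ger0_norm ?subr_ge0// addrC subrK.
have h (z : R[i]) : 0 <= z -> (ComplexField.Normc.normc z)%:C%C = z.
  by move=> z0; rewrite -[RHS]ger0_norm// normc_def; case: z {z0}.
apply: (@complexI R); rewrite rmorphD rmorph1/= !h ?subr_ge0//.
by rewrite addrC subrK.
Qed.

Lemma nbhs_modulus (x : (scalars R s)^o) (e : R) : 0 < e ->
  nbhs x [set y : (scalars R s)^o | modulus (x - y) < e].
Proof.
case: s x => x /= e0.
  by exists e.
exists e%:C%C => /=; first by rewrite ltcR.
move=> y /=; rewrite normc_def ltcR.
by case: (x - y).
Qed.

End modulus_theory.

(* The filter defining limits as |j| --> oo. *)
Definition int_infty : set_system int :=
  filter_from [set: nat] (fun N => [set j : int | (N <= `|j|)%N]).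

Global Instance int_infty_filter : Filter int_infty.
Proof.
apply: filter_from_filter => [|M N _ _]; first by exists 0%N.
by exists (maxn M N) => // j /=; rewrite geq_max => /andP[].
Qed.

(* l_p(Z) and its norm, on real sequences; p = 0 stands for c_0(Z). *)
Definition ell_mem (R : realType) (p : R) (f : int -> R) : Prop :=
  if p == 0 then f j @[j --> int_infty] --> (0 : R)
  else (\esum_(j in [set: int]) (`|f j| `^ p)%:E < +oo)%E.

Definition ell_norm (R : realType) (p : R) (f : int -> R) : R :=
  if p == 0 then sup [set `|f j| | j in [set: int]]
  else fine (\esum_(j in [set: int]) (`|f j| `^ p)%:E) `^ p^-1.

Record exponent (R : realType) := Exponent {
  exponent_val :> R;
  exponentP : (exponent_val == 0) || (1 <= exponent_val)
}.

Section ell_theory.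
Variables (R : realType) (p : exponent R).
Implicit Types f g : int -> R.

Let p_ge1 : (p == 0 :> R) = false -> 1 <= p :> R.
Proof. by case: p => q /= /orP[->|]. Qed.

Let esumZ (c : R) f : 0 <= c -> (forall j, 0 <= f j) ->
  (\esum_(j in [set: int]) (c * f j)%:E
    <= c%:E * \esum_(j in [set: int]) (f j)%:E)%E.
Proof.
move=> c0 f0; apply: ge_ereal_sup => _ [X [finX XI] <-].
have -> : (\sum_(j \in X) (c * f j)%:E = c%:E * \sum_(j \in X) (f j)%:E)%E.
  by rewrite ge0_mule_fsumr// => j; rewrite lee_fin.
by rewrite lee_wpmul2l ?lee_fin//; apply: ereal_sup_ubound; exists X.
Qed.

Lemma ell_mem_le f g : (forall j, 0 <= f j <= g j) ->
  ell_mem p g -> ell_mem p f.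
Proof.
move=> fg; rewrite /ell_mem; case: ifPn => [_ gc|p0]; last first.
  apply: le_lt_trans; apply: le_esum => j _; have /andP[f0 fgj] := fg j.
  have g0 := le_trans f0 fgj.
  rewrite lee_fin !ger0_norm// ge0_ler_powR//.
  by rewrite (le_trans ler01)// p_ge1// (negbTE p0).
apply: (@squeeze_cvgr _ _ _ _ (cst 0) g) => //; last exact: cvg_cst.
exact: nearW.
Qed.

Let powR_conv (a b u v : R) : 1 <= p :> R -> 0 <= a -> 0 <= b ->
  0 < u -> 0 < v ->
  ((a + b) / (u + v)) `^ p
    <= u / (u + v) * (a / u) `^ p + v / (u + v) * (b / v) `^ p.
Proof.
move=> p1 a0 b0 u0 v0; have uv0 : 0 < u + v by rewrite addr_gt0.
have t0 : 0 <= u / (u + v) by rewrite divr_ge0// ltW.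
have t1 : u / (u + v) <= 1 by rewrite ler_pdivrMr// mul1r lerDl ltW.
have au : 0 <= a / u by rewrite divr_ge0// ltW.
have bv : 0 <= b / v by rewrite divr_ge0// ltW.
have := convex_powR p1 (Itv01 t0 t1) (x := a / u) (y := b / v).
rewrite !inE/= !in_itv/= !andbT => /(_ au bv).
rewrite convRE [X in X `^ _ <= _ -> _]convRE /= /unstable.onem.
have -> : 1 - u / (u + v) = v / (u + v).
  by rewrite -[X in X - _](@mulfV _ (u + v)) ?gt_eqF// -mulrBl addrAC subrr add0r.
congr (_ `^ _ <= _).
have h (x y : R) : 0 < x -> x / (u + v) * (y / x) = y / (u + v).
  by move=> x0; rewrite mulrC mulrA divfK ?gt_eqF.
by rewrite !h// mulrDl.
Qed.

Let norm_le_esum f (u : R) : (p == 0 :> R) = false -> ell_mem p f -> 0 < u ->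
  (ell_norm p f <= u) =
  (\esum_(j in [set: int]) (`|f j| `^ p)%:E <= (u `^ p)%:E)%E.
Proof.
move=> p0 fl u0; have p1 := p_ge1 p0; have pp := lt_le_trans ltr01 p1.
move: fl; rewrite /ell_mem /ell_norm p0 => fl.
set E := esum _ _ in fl *.
have E0 : (0 <= E)%E by apply: esum_ge0 => j _; rewrite lee_fin powR_ge0.
have Efin : E \is a fin_num by rewrite ge0_fin_numE.
rewrite -[X in (X <= _)%E](fineK Efin) lee_fin; apply/idP/idP => h.
  have := ge0_ler_powR (ltW pp) (powR_ge0 _ _) (ltW u0) h.
  by rewrite -powRrM mulVf ?gt_eqF// powRr1// fine_ge0.
have := @ge0_ler_powR R (p : R)^-1 _ _ _ _ _ h.
rewrite invr_ge0 (ltW pp) !nnegrE fine_ge0// powR_ge0 => /(_ isT isT isT).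
by rewrite -powRrM mulfV ?gt_eqF// powRr1// ltW.
Qed.

Let esum_conv f g (u v : R) : 1 <= p :> R ->
  (forall j, 0 <= f j) -> (forall j, 0 <= g j) -> 0 < u -> 0 < v ->
  (\esum_(j in [set: int]) (`|f j + g j| `^ p)%:E <=
   ((u + v) `^ p)%:E *
   ((u / (u + v) * (u^-1 `^ p))%:E * (\esum_(j in [set: int]) (`|f j| `^ p)%:E) +
    (v / (u + v) * (v^-1 `^ p))%:E * \esum_(j in [set: int]) (`|g j| `^ p)%:E))%E.
Proof.
move=> p1 f0 g0 u0 v0; have uv0 : 0 < u + v by rewrite addr_gt0.
have cu : 0 <= u / (u + v) * (u^-1 `^ p).
  by rewrite mulr_ge0 ?powR_ge0// divr_ge0// ltW.
have cv : 0 <= v / (u + v) * (v^-1 `^ p).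
  by rewrite mulr_ge0 ?powR_ge0// divr_ge0// ltW.
set cu' := _ * _ in cu *; set cv' := _ * _ in cv *.
apply: (@le_trans _ _ (\esum_(j in [set: int])
   ((u + v) `^ p * (cu' * `|f j| `^ p + cv' * `|g j| `^ p))%:E)%E).
  apply: le_esum => j _; rewrite lee_fin.
  have := powR_conv p1 (f0 j) (g0 j) u0 v0.
  rewrite !ger0_norm ?addr_ge0// !powRM ?invr_ge0 ?addr_ge0 ?(ltW u0) ?(ltW v0)//.
  have uvE : (u + v) `^ p * (u + v)^-1 `^ p = 1.
    by rewrite -powRM ?invr_ge0 ?(ltW uv0)// mulfV ?gt_eqF// powR1.
  move=> /(ler_wpM2l (powR_ge0 (u + v) p)).
  rewrite [X in X <= _ -> _]mulrCA uvE mulr1.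
  move=> /le_trans; apply; rewrite le_eqVlt; apply/orP; left; apply/eqP.
  by rewrite /cu' /cv' [f j `^ _ * _]mulrC [g j `^ _ * _]mulrC !mulrA.
apply: (le_trans (esumZ _ _)) => [|j|].
- exact: powR_ge0.
- by rewrite addr_ge0// mulr_ge0// powR_ge0.
rewrite lee_wpmul2l ?lee_fin ?powR_ge0//.
under eq_esum do rewrite EFinD.
rewrite esumD; last 2 first.
- by move=> j _; rewrite lee_fin mulr_ge0// powR_ge0.
- by move=> j _; rewrite lee_fin mulr_ge0// powR_ge0.
by apply: leeD; apply: esumZ => // j; exact: powR_ge0.
Qed.

Lemma ell_memD f g : (forall j, 0 <= f j) -> (forall j, 0 <= g j) ->
  ell_mem p f -> ell_mem p g -> ell_mem p (fun j => f j + g j).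
Proof.
move=> f0 g0; rewrite /ell_mem; case: ifPn => [_ fc gc|p0 fl gl].
  by rewrite -[0]addr0; exact: cvgD.
have p1 := p_ge1 (negbTE p0).
apply: le_lt_trans (esum_conv p1 f0 g0 ltr01 ltr01) _.
have h (c : R) (x : \bar R) :
    0 <= c -> (x < +oo)%E -> (0 <= x)%E -> (c%:E * x < +oo)%E.
  move=> c0 xoo x0; rewrite -ge0_fin_numE ?mule_ge0 ?lee_fin//.
  by rewrite fin_numM// ge0_fin_numE.
have k : 0 <= 1 / (1 + 1) * 1^-1 `^ p :> R.
  by rewrite mulr_ge0 ?powR_ge0// divr_ge0.
have e0 (t : int -> R) : (0 <= \esum_(j in [set: int]) (`|t j| `^ p)%:E)%E.
  by apply: esum_ge0 => j _; rewrite lee_fin powR_ge0.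
apply: (h); first exact: powR_ge0.
  by apply: lte_add_pinfty; apply: (h).
by rewrite adde_ge0// mule_ge0 ?lee_fin.
Qed.

Lemma ell_memZ (c : R) f : 0 <= c -> (forall j, 0 <= f j) ->
  ell_mem p f -> ell_mem p (fun j => c * f j).
Proof.
move=> c0 f0; rewrite /ell_mem; case: ifPn => [_ fc|p0 fl].
  by rewrite -[0](mulr0 c); apply: cvgMr.
under eq_esum do rewrite normrM powRM//.
have e0 : (0 <= \esum_(j in [set: int]) (`|f j| `^ p)%:E)%E.
  by apply: esum_ge0 => j _; rewrite lee_fin powR_ge0.
apply: le_lt_trans (esumZ _ _) _ => [|j|]; rewrite ?powR_ge0//.
rewrite -ge0_fin_numE ?mule_ge0 ?lee_fin ?powR_ge0//.
by rewrite fin_numM// ge0_fin_numE.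
Qed.

Lemma ell_mem0 : ell_mem p (fun=> 0).
Proof.
rewrite /ell_mem; case: ifPn => [_|p0]; first exact: cvg_cst.
rewrite esum1// => j _; rewrite normr0 powR0//.
Qed.

Lemma ell_norm_ge0 f : 0 <= ell_norm p f.
Proof.
rewrite /ell_norm; case: ifPn => [_|p0]; last exact: powR_ge0.
have [bf|nbf] := pselect (has_ubound [set `|f j| | j in [set: int]]).
  by rewrite (le_trans (normr_ge0 (f 0)))//; apply: ub_le_sup => //; exists 0.
by rewrite sup_out// => -[].
Qed.

Lemma ell_norm0 : ell_norm p (fun=> 0) = 0.
Proof.
rewrite /ell_norm; case: ifPn => [_|p0].
  rewrite (_ : [set _ | _ in _] = [set 0]) ?sup1//.
  apply/seteqP; split=> [_ [j _ <-]|_ ->]; first by rewrite normr0.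
  by exists 0 => //; rewrite normr0.
rewrite esum1 => [|j _]; last by rewrite normr0 powR0.
by rewrite /= powR0// invr_eq0.
Qed.

Lemma ell_has_ubound f : (p == 0 :> R) -> (forall j, 0 <= f j) ->
  ell_mem p f -> has_ubound [set `|f j| | j in [set: int]].
Proof.
move=> p0 f0; rewrite /ell_mem p0 => /cvgrPdist_lt/(_ 1 ltr01)[N _ hN].
exists (1 + \sum_(i < N) (f i%:Z + f (- i%:Z))) => _ [j _ <-].
have S0 : 0 <= \sum_(i < N) (f i%:Z + f (- i%:Z)).
  by apply: sumr_ge0 => i _; rewrite addr_ge0.
have [Nj|jN] := leqP N `|j|%N.
  have := hN j Nj; rewrite /= sub0r normrN => /ltW/le_trans; apply.
  by rewrite lerDl.
rewrite ger0_norm// (bigD1 (Ordinal jN))//= addrCA.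
have h : f j <= f `|j|%N%:Z + f (- `|j|%N%:Z).
  have [j0|j0] := leP 0 j; first by rewrite gez0_abs// lerDl.
  by rewrite ltz0_abs// opprK lerDr.
apply: (le_trans h); rewrite lerDl addr_ge0// sumr_ge0// => i _.
by rewrite addr_ge0.
Qed.

Lemma ell_normD f g : (forall j, 0 <= f j) -> (forall j, 0 <= g j) ->
  ell_mem p f -> ell_mem p g ->
  ell_norm p (fun j => f j + g j) <= ell_norm p f + ell_norm p g.
Proof.
move=> f0 g0 fl gl; case p0 : (p == 0 :> R).
  have bf := ell_has_ubound p0 f0 fl; have bg := ell_has_ubound p0 g0 gl.
  rewrite /ell_norm p0; apply: ge_sup => [|_ [j _ <-]].
    by exists `|f 0 + g 0|, 0.
  rewrite (le_trans (ler_normD _ _))// lerD//.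
    by apply: ub_le_sup => //; exists j.
  by apply: ub_le_sup => //; exists j.
have p1 := p_ge1 p0.
apply/ler_addgt0Pr => e e0.
have e20 : 0 < e / 2 by rewrite divr_gt0.
suff h u v : ell_norm p f < u -> ell_norm p g < v ->
    ell_norm p (fun j => f j + g j) <= u + v.
  apply: le_trans (h (ell_norm p f + e / 2) (ell_norm p g + e / 2) _ _) _.
  - by rewrite ltrDl.
  - by rewrite ltrDl.
  - by rewrite addrACA -splitr.
move=> fu gv; have u0 := le_lt_trans (ell_norm_ge0 f) fu.
have v0 := le_lt_trans (ell_norm_ge0 g) gv.
have uv0 : 0 < u + v := addr_gt0 u0 v0.
rewrite norm_le_esum//; last exact: ell_memD.
apply: le_trans (esum_conv p1 f0 g0 u0 v0) _.
have hf : (\esum_(j in [set: int]) (`|f j| `^ p)%:E <= (u `^ p)%:E)%E.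
  by rewrite -norm_le_esum// ltW.
have hg : (\esum_(j in [set: int]) (`|g j| `^ p)%:E <= (v `^ p)%:E)%E.
  by rewrite -norm_le_esum// ltW.
have h (w : R) (x : \bar R) : 0 < w -> (x <= (w `^ p)%:E)%E ->
    ((w / (u + v) * w^-1 `^ p)%:E * x <= (w / (u + v))%:E)%E.
  move=> w0 xw; have c0 : 0 <= w / (u + v) * w^-1 `^ p.
    by rewrite mulr_ge0 ?powR_ge0// divr_ge0// ltW.
  apply: (le_trans (lee_wpmul2l _ xw)); first by rewrite lee_fin.
  rewrite -EFinM lee_fin.
  by rewrite -[leLHS]mulrA -powRM ?invr_ge0 ?(ltW w0)// mulVf ?gt_eqF// powR1 mulr1.
apply: (@le_trans _ _ (((u + v) `^ p)%:E * (u / (u + v) + v / (u + v))%:E)%E).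
  by rewrite lee_wpmul2l ?lee_fin ?powR_ge0// EFinD leeD// h.
by rewrite -mulrDl mulfV ?gt_eqF// mule1.
Qed.

Lemma ell_norm_le f g : (forall j, 0 <= f j <= g j) -> ell_mem p g ->
  ell_norm p f <= ell_norm p g.
Proof.
move=> fg gl; have fl := ell_mem_le fg gl.
have f0 j : 0 <= f j by case/andP: (fg j).
have g0 j : 0 <= g j by case/andP: (fg j) => /le_trans; apply.
case p0 : (p == 0 :> R).
  have bg := ell_has_ubound p0 g0 gl.
  rewrite /ell_norm p0; apply: ge_sup => [|_ [j _ <-]].
    by exists `|f 0|, 0.
  apply: (@le_trans _ _ `|g j|); last by apply: ub_le_sup => //; exists j.
  by rewrite !ger0_norm//; case/andP: (fg j).
have p1 := p_ge1 p0.
apply/ler_addgt0Pr => e e0.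
have ge0 : 0 < ell_norm p g + e by rewrite ltr_wpDl ?ell_norm_ge0.
rewrite norm_le_esum//.
have : ell_norm p g <= ell_norm p g + e by rewrite lerDl ltW.
rewrite norm_le_esum//; apply: le_trans; apply: le_esum => j _.
rewrite lee_fin ge0_ler_powR//; first exact: le_trans ler01 p1.
by rewrite !ger0_norm//; case/andP: (fg j).
Qed.

Lemma ell_normZ (c : R) f : 0 <= c -> (forall j, 0 <= f j) -> ell_mem p f ->
  ell_norm p (fun j => c * f j) <= c * ell_norm p f.
Proof.
move=> c0 f0 fl; case p0 : (p == 0 :> R).
  have bf := ell_has_ubound p0 f0 fl.
  rewrite /ell_norm p0; apply: ge_sup => [|_ [j _ <-]].
    by exists `|c * f 0|, 0.
  rewrite normrM (ger0_norm c0) ler_wpM2l//.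
  by apply: ub_le_sup => //; exists j.
have p1 := p_ge1 p0; have pp := lt_le_trans ltr01 p1.
have e0 : (0 <= \esum_(j in [set: int]) (`|f j| `^ p)%:E)%E.
  by apply: esum_ge0 => j _; rewrite lee_fin powR_ge0.
have efin : \esum_(j in [set: int]) (`|f j| `^ p)%:E \is a fin_num.
  by move: fl; rewrite /ell_mem p0 ge0_fin_numE.
rewrite /ell_norm p0.
have -> : c * fine (\esum_(j in [set: int]) (`|f j| `^ p)%:E) `^ (p : R)^-1 =
    (c `^ p * fine (\esum_(j in [set: int]) (`|f j| `^ p)%:E)) `^ (p : R)^-1.
  rewrite powRM ?powR_ge0 ?fine_ge0// -powRrM mulfV ?gt_eqF//.
  by rewrite powRr1.
have := ell_memZ c0 f0 fl; rewrite /ell_mem p0 => cfl.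
have ce0 : (0 <= \esum_(j in [set: int]) (`|c * f j| `^ p)%:E)%E.
  by apply: esum_ge0 => j _; rewrite lee_fin powR_ge0.
apply: ge0_ler_powR; rewrite ?nnegrE ?invr_ge0 ?(ltW pp) ?fine_ge0//.
  by rewrite mulr_ge0 ?powR_ge0 ?fine_ge0.
rewrite -lee_fin EFinM !fineK// ?ge0_fin_numE//.
under eq_esum do rewrite normrM powRM// (ger0_norm c0).
by apply: esumZ => *; exact: powR_ge0.
Qed.

End ell_theory.

(* [A j k] is the entry a_{j,k+1}: the index set {1, 2, ...} of the second
   variable, only used through its order, is replaced by nat. *)
Record kothe_matrix (R : realType) := KotheMatrix {
  kothe_entry :> int -> nat -> R;
  kothe_entry_ge0 : forall j k, 0 <= kothe_entry j k;
  kothe_entry_nondecreasing : forall j k,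
    kothe_entry j k <= kothe_entry j k.+1;
  kothe_entry_pos : forall j, exists k, 0 < kothe_entry j k
}.

Definition kothe_mem (R : realType) (s : scalar_kind) (A : kothe_matrix R)
    (p : exponent R) (x : int -> scalars R s) : Prop :=
  forall k, ell_mem p (fun j => A j k * modulus (x j)).

Definition kothe_pred (R : realType) (s : scalar_kind) (A : kothe_matrix R)
    (p : exponent R) : {pred int -> (scalars R s)^o} :=
  mem [set x : int -> (scalars R s)^o | kothe_mem A p x].
Arguments kothe_pred {R} s A p.

Record kothe_space (R : realType) (s : scalar_kind) (A : kothe_matrix R)
    (p : exponent R) := KotheSpace {
  kothe_val :> int -> scalars R s;
  kothe_valP : (kothe_val : int -> (scalars R s)^o) \in kothe_pred s A p
}.
Arguments kothe_space {R} s A p.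

Definition kothe_seminorm (R : realType) (s : scalar_kind)
    (A : kothe_matrix R) (p : exponent R) (k : nat)
    (x : kothe_space s A p) : R :=
  ell_norm p (fun j => A j k * modulus (x j)).

Section kothe_lmodule.
Variables (R : realType) (s : scalar_kind) (A : kothe_matrix R).
Variable p : exponent R.

HB.instance Definition _ := [isSub for
  (@kothe_val R s A p : kothe_space s A p -> (int -> (scalars R s)^o))].
HB.instance Definition _ := [Choice of kothe_space s A p by <:].

Let wge0 k (x : int -> scalars R s) j : 0 <= A j k * modulus (x j).
Proof. by rewrite mulr_ge0 ?kothe_entry_ge0 ?modulus_ge0. Qed.

Lemma kothe_submod_closed : submod_closed (kothe_pred s A p).
Proof.
split.
  rewrite inE => k /=.
  apply: ell_mem_le (ell_mem0 p) => j.
  by rewrite wge0 [X in modulus X](_ : _ = 0)// modulus0 mulr0/=.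
move=> a x y; rewrite !inE => xl yl k /=.
have := ell_memD _ _ (ell_memZ (modulus_ge0 a) (wge0 k x) (xl k)) (yl k).
move=> H; apply: ell_mem_le (H _ _) => [j|j|]; last exact: wge0.
  rewrite wge0/= mulrCA -mulrDr ler_wpM2l ?kothe_entry_ge0//.
  by rewrite (le_trans (modulusD _ _))// modulusM.
by rewrite mulr_ge0 ?modulus_ge0.
Qed.

HB.instance Definition _ :=
  GRing.isSubmodClosed.Build _ _ (kothe_pred s A p) kothe_submod_closed.
HB.instance Definition _ :=
  [SubChoice_isSubLmodule of kothe_space s A p by <:].

End kothe_lmodule.

Section kothe_topology.
Variables (R : realType) (s : scalar_kind) (A : kothe_matrix R).
Variable p : exponent R.
Local Notation X := (kothe_space s A p).
Local Notation q := (@kothe_seminorm R s A p).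
Implicit Types x y : X.

Let wge0 k x j : 0 <= A j k * modulus (x j).
Proof. by rewrite mulr_ge0 ?kothe_entry_ge0 ?modulus_ge0. Qed.

Let wmem k x : ell_mem p (fun j => A j k * modulus (x j)).
Proof. by have := kothe_valP x; rewrite inE; exact. Qed.

Lemma kothe_seminorm_ge0 k x : 0 <= q k x.
Proof. exact: ell_norm_ge0. Qed.

Lemma kothe_seminorm0 k : q k 0 = 0.
Proof.
apply/eqP; rewrite eq_le kothe_seminorm_ge0 andbT -(ell_norm0 p).
apply: ell_norm_le (ell_mem0 p) => j.
by rewrite wge0 [X in modulus X](_ : _ = 0)// modulus0 mulr0/=.
Qed.

Lemma kothe_seminormD k x y : q k (x + y) <= q k x + q k y.
Proof.
apply: le_trans (ell_normD (wge0 k x) (wge0 k y) (wmem k x) (wmem k y)).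
apply: ell_norm_le => [j|]; last first.
  by apply: ell_memD; [exact: wge0|exact: wge0|exact: wmem|exact: wmem].
rewrite wge0/= -mulrDr ler_wpM2l ?kothe_entry_ge0//.
exact: modulusD.
Qed.

Lemma kothe_seminormZ k (a : scalars R s) x : q k (a *: x) <= modulus a * q k x.
Proof.
apply: le_trans (ell_normZ (modulus_ge0 a) (wge0 k x) (wmem k x)).
apply: ell_norm_le => [j|]; last first.
  by apply: ell_memZ; [exact: modulus_ge0|exact: wge0|exact: wmem].
by rewrite wge0/= mulrCA ler_wpM2l ?kothe_entry_ge0// -modulusM.
Qed.

Lemma kothe_seminorm_le k l x : (k <= l)%N -> q k x <= q l x.
Proof.
move=> kl; apply: ell_norm_le (wmem l x) => j.
rewrite wge0/= ler_wpM2r ?modulus_ge0//.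
elim: l kl => [|l IH]; first by rewrite leqn0 => /eqP ->.
rewrite leq_eqVlt => /predU1P[->//|/IH/le_trans]; apply.
exact: kothe_entry_nondecreasing.
Qed.

Definition kothe_ball x k (e : R) : set X := [set y | q k (y - x) < e].

(* Finite intersections of seminorm balls centered at x are not needed since
   the seminorms are increasing. *)
Definition kothe_nbhs x : set_system X :=
  filter_from [set ke : nat * R | 0 < ke.2] (fun ke => kothe_ball x ke.1 ke.2).

HB.instance Definition _ := hasNbhs.Build X kothe_nbhs.

Let ballP x k (e : R) : 0 < e -> nbhs x (kothe_ball x k e).
Proof. by move=> e0; exists (k, e). Qed.

Let ball_center x k (e : R) : 0 < e -> kothe_ball x k e x.
Proof. by move=> e0; rewrite /kothe_ball/= subrr kothe_seminorm0. Qed.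

Let kothe_filter x : ProperFilter (nbhs x).
Proof.
apply: filter_from_proper; last first.
  by move=> [k e] /= e0; exists x; exact: ball_center.
apply: filter_from_filter; first by exists (0%N, 1) => /=.
move=> [k e] [l f] /= e0 f0; exists (maxn k l, Num.min e f) => /=.
  by rewrite lt_min e0.
have me : Num.min e f <= e by rewrite ge_min lexx.
have mf : Num.min e f <= f by rewrite ge_min lexx orbT.
move=> y yb; split.
  exact: le_lt_trans (kothe_seminorm_le _ (leq_maxl k l)) (lt_le_trans yb me).
exact: le_lt_trans (kothe_seminorm_le _ (leq_maxr k l)) (lt_le_trans yb mf).
Qed.

Let kothe_nbhs_singleton x (U : set X) : nbhs x U -> U x.
Proof. by move=> [[k e] /= e0 eU]; apply: eU; exact: ball_center. Qed.

Let nbhs_ball x y k (e : R) : kothe_ball x k e y -> nbhs y (kothe_ball x k e).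
Proof.
move=> xy; exists (k, e - q k (y - x)) => /=; first by rewrite subr_gt0.
move=> z /= yz; rewrite /kothe_ball/= -(subrK y z) -addrA.
by rewrite (le_lt_trans (kothe_seminormD _ _ _))// -ltrBrDr.
Qed.

Let kothe_nbhs_nbhs x (U : set X) : nbhs x U -> nbhs x (nbhs^~ U).
Proof.
move=> [[k e] /= e0 eU]; exists (k, e) => //= y /nbhs_ball.
exact: (@filterS _ _ (kothe_filter y)).
Qed.

HB.instance Definition _ := Nbhs_isNbhsTopological.Build X
  kothe_filter kothe_nbhs_singleton kothe_nbhs_nbhs.

Let kothe_add_continuous : continuous (fun x : X * X => x.1 + x.2).
Proof.
move=> [x y] U /= [[k e] /= e0 eU].
have e20 : 0 < e / 2 by rewrite divr_gt0.
exists (kothe_ball x k (e / 2), kothe_ball y k (e / 2)).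
  by split; exact: ballP.
move=> [x' y'] [/= hx hy]; apply: eU; rewrite /kothe_ball/=.
rewrite opprD addrACA; apply: le_lt_trans (kothe_seminormD _ _ _) _.
rewrite (splitr e); exact: ltrD hx hy.
Qed.

Let kothe_scale_continuous :
  continuous (fun z : (scalars R s)^o * X => z.1 *: z.2).
Proof.
move=> [a x] U /= [[k e] /= e0 eU].
have e20 : 0 < e / 2 by rewrite divr_gt0.
have x1 : 0 < q k x + 1 by rewrite ltr_wpDl ?kothe_seminorm_ge0.
have a1 : 0 < modulus a + 1 by rewrite ltr_wpDl ?modulus_ge0.
pose d := Num.min 1 (e / 2 / (q k x + 1)).
have d0 : 0 < d by rewrite lt_min ltr01 divr_gt0.
exists ([set b : (scalars R s)^o | modulus (a - b) < d],
        kothe_ball x k (e / 2 / (modulus a + 1))).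
  by split; [exact: nbhs_modulus|apply: ballP; rewrite divr_gt0].
move=> [b y] [/=]; rewrite lt_min => /andP[ab1 ab] xy; apply: eU.
rewrite /kothe_ball/=.
have -> : b *: y - a *: x = b *: (y - x) + (b - a) *: x.
  by rewrite scalerBr scalerBl addrA subrK.
apply: le_lt_trans (kothe_seminormD _ _ _) _.
rewrite (splitr e); apply: ltr_leD.
  apply: le_lt_trans (kothe_seminormZ _ _ _) _.
  have ba : modulus b <= modulus a + 1.
    rewrite -[b](subrK a) addrC (le_trans (modulusD _ _))// lerD2l.
    by rewrite -modulusN opprB ltW.
  apply: (@le_lt_trans _ _ ((modulus a + 1) * q k (y - x))).
    by rewrite ler_wpM2r// kothe_seminorm_ge0.
  by rewrite mulrC -ltr_pdivlMr.
apply: le_trans (kothe_seminormZ _ _ _) _.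
rewrite -modulusN opprB.
apply: (@le_trans _ _ (modulus (a - b) * (q k x + 1))).
  by rewrite ler_wpM2l ?modulus_ge0// lerDl.
by rewrite -ler_pdivlMr// ltW.
Qed.

Let convex_lt (a b u v e : R) : 0 <= a -> 0 <= b -> a + b = 1 ->
  u < e -> v < e -> a * u + b * v < e.
Proof.
move=> a0 b0 ab ue ve; rewrite -[ltRHS]mul1r -ab mulrDl.
move: a0; rewrite le_eqVlt => /predU1P[a0|a0].
  by move: ab; rewrite -a0 !mul0r !add0r => ->; rewrite !mul1r.
by apply: ltr_leD; [rewrite ltr_pM2l|rewrite ler_wpM2l// ltW].
Qed.

Let kothe_locally_convex : exists2 B : set_system X,
  (forall b, b \in B -> convex_set b) & basis B.
Proof.
exists [set B | exists x k e, B = kothe_ball x k e].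
  move=> _ /[!inE]/= -[x [k [e ->]]].
  apply/convex_setW => y z /set_mem xy /set_mem xz t t0 t1; apply/mem_set.
  pose a := t%:num; change (q k (a *: y + (1 - a) *: z - x) < e).
  have E : a *: y + (1 - a) *: z - x = a *: (y - x) + (1 - a) *: (z - x).
    rewrite !scalerBr addrACA -opprD -scalerDl.
    by rewrite [a + _]addrC subrK scale1r.
  rewrite E; apply: le_lt_trans (kothe_seminormD _ _ _) _.
  have aE := @modulus_convex R s a (ltW t0) (ltW t1).
  apply: le_lt_trans (lerD (kothe_seminormZ _ _ _) (kothe_seminormZ _ _ _)) _.
  exact: convex_lt (modulus_ge0 _) (modulus_ge0 _) aE xy xz.
split => [_ [x [k [e ->]]]|x U [[k e] /= e0 eU]].
  by rewrite openE => y xy; exact: nbhs_ball.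
exists (kothe_ball x k e) => //; split; first by exists x, k, e.
exact: ball_center.
Qed.

HB.instance Definition _ := PreTopologicalLmod_isTvs.Build (scalars R s) X
  kothe_add_continuous kothe_scale_continuous kothe_locally_convex.
(* The factory above only declares the uniform structure. *)
HB.instance Definition _ :=
  PreTopologicalNmodule_isTopologicalNmodule.Build X kothe_add_continuous.
HB.instance Definition _ := TopologicalNmodule_isTopologicalLmodule.Build
  (scalars R s) X kothe_scale_continuous.
HB.instance Definition _ :=
  Uniform_isTvs.Build (scalars R s) X kothe_locally_convex.

End kothe_topology.

(* Invertible operators, i.e. the elements of GL(X). *)
Record invertible_operator (K : numFieldType) (X : tvsType K) :=
  InvertibleOperator {
    op :> {linear X -> X};
    op_inv : X -> X;
    op_continuous : continuous op;
    op_inv_continuous : continuous op_inv;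
    opK : cancel op op_inv;
    op_invK : cancel op_inv op
  }.

Definition diverges_uniformly_on (R : realType) (T : Type) (S : set T)
    (f : nat -> T -> R) : Prop :=
  forall M : R, \forall n \near \oo, forall x, S x -> M <= f n x.

Definition uniformly_expansive (R : realType) (K : numFieldType)
    (X : tvsType K) (q : nat -> X -> R) (T : invertible_operator X) : Prop :=
  forall k, exists l, exists Sp Sm : set X,
    [/\ [set x | q k x = 1] = Sp `|` Sm,
        diverges_uniformly_on Sp (fun n x => q l (iter n T x)) &
        diverges_uniformly_on Sm (fun n x => q l (iter n (op_inv T) x))].

Definition weighted_shift (R : realType) (s : scalar_kind)
    (w : int -> scalars R s) (x : int -> scalars R s) : int -> scalars R s :=
  fun j => w (j - 1) * x (j - 1).

Definition index_support (R : realType) (A : kothe_matrix R) (k : nat) :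
    set int :=
  [set j | A j k != 0].

(* a_{j+n,l} |w_j ... w_{j+n-1}| / a_{j,k} *)
Definition forward_ratio (R : realType) (s : scalar_kind)
    (A : kothe_matrix R) (w : int -> scalars R s) (k l n : nat) (j : int) : R :=
  A (j + n%:Z) l * modulus (\prod_(i < n) w (j + i%:Z)) / A j k.

(* a_{j-n,l} / (a_{j,k} |w_{j-n} ... w_{j-1}|) *)
Definition backward_ratio (R : realType) (s : scalar_kind)
    (A : kothe_matrix R) (w : int -> scalars R s) (k l n : nat) (j : int) : R :=
  A (j - n%:Z) l / (A j k * modulus (\prod_(i < n) w (j - n%:Z + i%:Z))).

(* Main.v *)
Require Import Defs.
From mathcomp Require Import all_boot all_order all_algebra complex.
From mathcomp Require Import all_classical all_reals all_analysis.

Set Implicit Arguments.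
Unset Strict Implicit.
Unset Printing Implicit Defensive.

Import Order.TTheory GRing.Theory Num.Theory.
Import numFieldNormedType.Exports.

Local Open Scope classical_set_scope.
Local Open Scope ring_scope.

(** A potential of the weights is a positive family W with
    W (j + 1) = |w_j| W j.  With b j k = a_{j,k} W j, the two families of
    quotients in the statement become b (j + n) l / b j k and
    b (j - n) l / b j k: conjugating by W replaces the weighted shift by the
    unweighted one on the Koethe matrix b, and reversing the index j exchanges
    the shift and its inverse.

    The first half of the proof translates uniform expansivity into growth of
    matrix entries ([uniformly_expansive_splitting]): for each k there are l
    and a splitting of the indices into a forward part, on which
    b (j + n) l / b j k tends to infinity uniformly in j, and a backward part,
    with the same property of b (j - n) l / b j k.  One direction tests the
    definition on the normalized unit vectors ([diverges_blows_up]);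
    conversely, a vector x with ||x||_k = 1 has norm at least 1/2 on one of the
    two parts, and this portion of x grows under the forward or the backward
    iterates ([blows_up_diverges]).

    The second half is purely about the matrix ([growth_splittingP]).  If
    neither (A) nor (B) holds, then for some K both parts of the splitting at
    level K contain an index whose entry at K is nonzero.  Let i be such an
    index in the forward part, let l be the level where its orbit grows, let
    m >= l, and let m' be the level associated with m.  If i + n belonged to
    the backward part at level m for large n, then going n steps back would
    bound b (i + n) m by the fixed number b i m', whereas already b (i + n) l
    tends to infinity with n.  Hence all large indices belong to
    the forward part at level m ([blows_up_avoids]); the finitely many
    remaining positive indices also grow, because their forward orbits run
    through the same entries as the orbit of i.  By reflection all negative
    indices grow backward, which is (C). *)

(** * Growth of matrix entries along the shift *)

Lemma kothe_entry_le (R : realType) (B : kothe_matrix R) j k l :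
  (k <= l)%N -> B j k <= B j l.
Proof.
apply: (homo_leq (f := B j) (r := fun x y => x <= y)) => [//|x y z|{}k].
  exact: le_trans.
exact: kothe_entry_nondecreasing.
Qed.

Definition reflect_matrix (R : realType) (B : kothe_matrix R) :
    kothe_matrix R :=
  @KotheMatrix R (fun j => B (- j)) (fun j => kothe_entry_ge0 B (- j))
    (fun j => kothe_entry_nondecreasing B (- j))
    (fun j => kothe_entry_pos B (- j)).

(** Written with a product rather than a quotient, so that the indices outside
    the support of the k-th column satisfy it trivially. *)
Definition blows_up (R : realType) (B : kothe_matrix R) (S : set int)
    (k l : nat) : Prop :=
  forall M : R, \forall n \near \oo, forall j, S j ->
    M * B j k <= B (j + n%:Z) l.

Lemma blows_upS (R : realType) (B : kothe_matrix R) (S S' : set int)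
    (k k' l l' : nat) :
  S' `<=` S -> (k' <= k)%N -> (l <= l')%N ->
  blows_up B S k l -> blows_up B S' k' l'.
Proof.
move=> SS kk ll bS M.
(* A negative M would reverse the comparison of the entries at k' and k. *)
have := bS (Num.max 0 M); apply: filterS => n h j /SS /h {}h.
apply: le_trans (le_trans h (kothe_entry_le _ _ ll)).
apply: (@le_trans _ _ (Num.max 0 M * B j k')).
  by rewrite ler_wpM2r ?kothe_entry_ge0// le_max lexx orbT.
by rewrite ler_wpM2l ?kothe_entry_le// le_max lexx.
Qed.

Lemma blows_upU (R : realType) (B : kothe_matrix R) (S S' : set int)
    (k l : nat) :
  blows_up B S k l -> blows_up B S' k l -> blows_up B (S `|` S') k l.
Proof.
move=> bS bS' M; have := bS' M; have := bS M.
by apply: filterS2 => n h h' j [/h|/h'].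
Qed.

Lemma blows_up_null (R : realType) (B : kothe_matrix R) (S : set int)
    (k l : nat) :
  (forall j, S j -> B j k = 0) -> blows_up B S k l.
Proof.
by move=> S0 M; apply: nearW => n j /S0 ->; rewrite mulr0 kothe_entry_ge0.
Qed.

(** A single growing orbit sees every sufficiently large index, so the whole
    column tends to infinity on the right. *)
Lemma blows_up_tail (R : realType) (B : kothe_matrix R) (S : set int)
    (k l : nat) (i : int) :
  blows_up B S k l -> S i -> 0 < B i k ->
  forall M : R, exists J : int, forall j, J <= j -> M <= B j l.
Proof.
move=> bS Si Bi M; have [N _ hN] := bS (M / B i k).
exists (i + N%:Z) => j ij.
have ji : (`|j - i|%N)%:Z = j - i.
  by rewrite gez0_abs// subr_ge0 (le_trans _ ij)// lerDl.
have := hN `|j - i|%N; rewrite /= -lez_nat ji lerBrDl => /(_ ij i Si).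
by rewrite divfK ?gt_eqF// addrC subrK.
Qed.

(** The forward orbit of j ends up in the tail described by [blows_up_tail], so
    one growing orbit makes every single orbit grow. *)
Lemma blows_up_point (R : realType) (B : kothe_matrix R) (S : set int)
    (k l m : nat) (i j : int) :
  blows_up B S k l -> S i -> 0 < B i k -> blows_up B [set j] m l.
Proof.
move=> bS Si Bi M; have [J hJ] := blows_up_tail bS Si Bi (M * B j m).
exists `|J - j|%N => // n /= Jn _ ->; apply: hJ.
by rewrite -lerBlDl; apply: le_trans (ler_norm _) _; rewrite -abszE lez_nat.
Qed.

Lemma blows_up_halfline (R : realType) (B : kothe_matrix R) (c J : int)
    (k l : nat) :
  blows_up B [set j | J <= j] k l ->
  (forall j, blows_up B [set j] k l) ->
  blows_up B [set j | c <= j] k l.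
Proof.
move=> bJ bpt.
have step d : blows_up B [set j | J - d%:Z <= j] k l.
  elim: d => [|d IH]; first by rewrite subr0.
  apply: blows_upS (blows_upU (bpt (J - d.+1%:Z)) IH) => // j /=.
  rewrite le_eqVlt => /predU1P[<-|]; first by left.
  by rewrite -lezD1 intS opprD addrA addrAC subrK; right.
apply: blows_upS (step `|J - c|%N) => // j /=; apply: le_trans.
by rewrite lerBlDr -lerBlDl abszE ler_norm.
Qed.

(** If - Q contained indices i + n with n arbitrarily large, growth along the
    reflected shift would give B (i + n) m <= B i m' for these n, although the
    orbit of i tends to infinity. *)
Lemma blows_up_avoids (R : realType) (B : kothe_matrix R) (P Q : set int)
    (k l m m' : nat) (i : int) :
  blows_up B P k l -> P i -> 0 < B i k -> (l <= m)%N ->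
  blows_up (reflect_matrix B) Q m m' ->
  exists J : int, forall j, J <= j -> ~ Q (- j).
Proof.
move=> bP Pi Bi lm bQ.
have [N _ hN] := bQ 1.
have [J hJ] := blows_up_tail bP Pi Bi (B i m' + 1).
exists (Num.max J (i + N%:Z)) => j; rewrite ge_max => /andP[Jj Nj] Qj.
have ji : (`|j - i|%N)%:Z = j - i.
  by rewrite gez0_abs// subr_ge0 (le_trans _ Nj)// lerDl.
have := hN `|j - i|%N; rewrite /= -lez_nat ji lerBrDl => /(_ Nj _ Qj).
rewrite mul1r opprD !opprK addrC opprB subrK.
move=> /(le_trans (kothe_entry_le _ _ lm))/(le_trans (hJ j Jj)).
by rewrite gerDl leNgt ltr01.
Qed.

(** The second set is given in the reflected coordinate, which makes the notion
    invariant under exchanging the two shifts. *)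
Definition growth_splitting (R : realType) (B : kothe_matrix R) : Prop :=
  forall k, exists l (P Q : set int),
    [/\ forall j : int, P j \/ Q (- j), blows_up B P k l &
        blows_up (reflect_matrix B) Q k l].

(** One index growing forward at a low level forces forward growth of the whole
    positive half-line at every higher level: beyond some J the splitting
    (P', Q') can only use P', and below J each index has a growing orbit. *)
Lemma blows_up_positive (R : realType) (B : kothe_matrix R) (P P' Q' : set int)
    (k l m m' : nat) (i : int) :
  blows_up B P k l -> P i -> 0 < B i k -> (l <= m)%N -> (l <= m')%N ->
  (forall j : int, P' j \/ Q' (- j)) ->
  blows_up B P' m m' -> blows_up (reflect_matrix B) Q' m m' ->
  blows_up B [set j | 0 < j] m m'.
Proof.
move=> bP Pi Bi lm lm' PQ bP' bQ'.
have [J hJ] := blows_up_avoids bP Pi Bi lm bQ'.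
have bP2 := blows_upS (@subset_refl _ P) (leqnn k) lm' bP.
apply: (@blows_upS _ _ [set j | 0 <= j] _ m _ m') => //.
  by move=> j /= /ltW.
apply: (@blows_up_halfline _ _ _ J).
  by apply: blows_upS bP' => // j /= /hJ; case: (PQ j).
by move=> j; exact: blows_up_point bP2 Pi Bi.
Qed.

(** The two sets of a splitting may change with k.  That they can be replaced by
    all indices, or by the two half-lines, comes from applying
    [blows_up_positive] to B and to its reflection as soon as both sets
    meet the support of one column. *)
Lemma growth_splittingP (R : realType) (B : kothe_matrix R) :
  growth_splitting B <->
  [\/ forall k, exists l, blows_up B setT k l,
      forall k, exists l, blows_up (reflect_matrix B) setT k l
    | forall k, exists l, blows_up B [set j | 0 < j] k l /\
        blows_up (reflect_matrix B) [set j | 0 < j] k l].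
Proof.
split=> [sB|[bB k|bB k|bB k]]; last 3 first.
- have [l bl] := bB k; exists l, setT, set0; split => //; first by left.
  by move=> M; apply: nearW => n j [].
- have [l bl] := bB k; exists l, set0, setT; split => //; first by right.
  by move=> M; apply: nearW => n j [].
- have [k' Bk'] := kothe_entry_pos B 1.
  (* Neither half of (C) covers the index 0; its forward orbit passes through 1,
     which grows at any level k' where its entry is nonzero. *)
  have [l [bP bQ]] := bB (maxn k k').
  have B1 := lt_le_trans Bk' (kothe_entry_le B 1 (leq_maxr k k')).
  exists l, ([set j | 0 < j] `|` [set 0]), [set j | 0 < j]; split.
  + move=> j /=; rewrite oppr_gt0.
    by case: (ltgtP j 0) => [|//|->]; [right|left; left|left; right].
  + apply: blows_upU; last exact: (blows_up_point _ _ bP _ B1).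
    exact: blows_upS (leq_maxl k k') _ bP.
  + exact: blows_upS (leq_maxl k k') _ bQ.
have [bB|/existsNP[k0 nk0]] :=
  pselect (forall k, exists l, blows_up B setT k l); first by constructor 1.
have [bB|/existsNP[k1 nk1]] :=
  pselect (forall k, exists l, blows_up (reflect_matrix B) setT k l).
  by constructor 2.
constructor 3.
(* K is a level at which both (A) and (B) fail, hence at which each of the two
   sets meets the support of the column. *)
pose K := maxn k0 k1; have [l [P [Q [PQ bP bQ]]]] := sB K.
have [[i Pi Bi]|nP] := pselect (exists2 i, P i & 0 < B i K); last first.
  exfalso; apply: nk1; exists l.
  apply: (@blows_upS _ _ (Q `|` ~` Q) _ K _ l) => //; rewrite ?leq_maxr//.
    by rewrite setUv.
  apply: blows_upU => //; apply: blows_up_null => j nQj /=.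
  have [Pj|] := PQ (- j); last by rewrite opprK.
  apply/eqP; rewrite eq_le kothe_entry_ge0 andbT leNgt; apply/negP => Bj.
  by apply: nP; exists (- j).
have [[i' Qi Bi']|nQ] := pselect (exists2 i, Q i & 0 < reflect_matrix B i K);
    last first.
  exfalso; apply: nk0; exists l.
  apply: (@blows_upS _ _ (P `|` ~` P) _ K _ l) => //; rewrite ?leq_maxl//.
    by rewrite setUv.
  apply: blows_upU => //; apply: blows_up_null => j nPj /=.
  have [//|Qj] := PQ j.
  apply/eqP; rewrite eq_le kothe_entry_ge0 andbT leNgt; apply/negP => Bj.
  by apply: nQ; exists (- j) => //=; rewrite opprK.
move=> k; pose m := maxn k l; have [m' [P' [Q' [PQ' bP' bQ']]]] := sB m.
have lm : (l <= m)%N by rewrite leq_maxr.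
have km : (k <= m)%N by rewrite leq_maxl.
have lM : (l <= maxn l m')%N by rewrite leq_maxl.
have {}bP' := blows_upS (@subset_refl _ _) (leqnn m) (leq_maxr l m') bP'.
have {}bQ' := blows_upS (@subset_refl _ _) (leqnn m) (leq_maxr l m') bQ'.
exists (maxn l m'); split.
  apply: blows_upS (@subset_refl _ _) km (leqnn _) _.
  exact: blows_up_positive bP Pi Bi lm lM PQ' bP' bQ'.
apply: blows_upS (@subset_refl _ _) km (leqnn _) _.
apply: (blows_up_positive (Q' := P') bQ Qi Bi' lm lM _ bQ').
  by move=> j; have [] := PQ' (- j); rewrite ?opprK; [right|left].
by move=> M; have := bP' M; apply: filterS => n h j /h /=; rewrite !opprK.
Qed.

(** * Norms on weighted sequence spaces *)

Lemma modulus1 (R : realType) (s : scalar_kind) :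
  modulus (1 : scalars R s) = 1.
Proof.
have := @modulus_convex R s 0 (lexx 0) ler01.
by rewrite modulus0 add0r subr0.
Qed.

Lemma modulus_gt0 (R : realType) (s : scalar_kind) (x : scalars R s) :
  x != 0 -> 0 < modulus x.
Proof.
move=> x0; rewrite lt_def modulus_ge0 andbT; apply/eqP => mx0.
have := @modulus1 R s; rewrite -(mulfV x0) modulusM mx0 mul0r => /eqP.
by rewrite eq_sym oner_eq0.
Qed.

Lemma modulus_surj (R : realType) (s : scalar_kind) (r : R) :
  0 <= r -> exists c : scalars R s, modulus c = r.
Proof.
case: s => r0 /=; first by exists r; exact: ger0_norm.
by exists (r%:C)%C; rewrite /= expr0n addr0 sqrtr_sqr ger0_norm.
Qed.

Lemma esum_powR_point (R : realType) (p : R) (f : int -> R) (i : int) :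
  p != 0 -> (forall j, j != i -> f j = 0) ->
  (\esum_(j in [set: int]) (`|f j| `^ p)%:E = (`|f i| `^ p)%:E)%E.
Proof.
move=> p0 f0.
rewrite -(@esum_set1 _ _ i (fun j => (`|f j| `^ p)%:E)) ?lee_fin ?powR_ge0//.
rewrite [RHS]esum_mkcond; apply: eq_esum => j _.
have [->|ji] := eqVneq j i; first by rewrite mem_set.
by rewrite f0// normr0 powR0// if_same.
Qed.

Lemma ell_mem_point (R : realType) (p : exponent R) (f : int -> R) (i : int) :
  (forall j, j != i -> f j = 0) -> ell_mem p f.
Proof.
move=> f0; rewrite /ell_mem; case: ifPn => [_|p0].
  apply: cvg_near_cst.
  exists `|i|.+1 => // j /= ij; apply: f0; apply: contraTneq ij => ->.
  by rewrite ltnn.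
by rewrite (esum_powR_point _ f0) ?ltry.
Qed.

Lemma ell_norm_point (R : realType) (p : exponent R) (f : int -> R) (i : int) :
  (forall j, j != i -> f j = 0) -> ell_norm p f = `|f i|.
Proof.
move=> f0; rewrite /ell_norm; case: ifPn => [_|p0].
  apply/eqP; rewrite eq_le; apply/andP; split.
    apply: ge_sup => [|_ [j _ <-]]; first by exists `|f 0|, 0.
    by have [->//|/f0 ->] := eqVneq j i; rewrite normr0.
  apply: ub_le_sup; last by exists i.
  exists `|f i| => _ [j _ <-].
  by have [->//|/f0 ->] := eqVneq j i; rewrite normr0.
rewrite (esum_powR_point p0 f0).
by rewrite /= -powRrM mulfV// powRr1.
Qed.

Lemma ell_norm_reindex (R : realType) (p : exponent R) (f : int -> R)
    (e : int -> int) :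
  bijective e -> ell_norm p (f \o e) = ell_norm p f.
Proof.
move=> be; rewrite /ell_norm; case p0 : (p == 0 :> R).
  congr sup; apply/seteqP; split=> _ [j _ <-]; first by exists (e j).
  by have [e' _ e'K] := be; exists (e' j) => //=; rewrite e'K.
rewrite (reindex_esum setT setT e (fun j => (`|f j| `^ p)%:E))//.
by rewrite setTT_bijective.
Qed.

Lemma ler_ell_norm_moved (R : realType) (p : exponent R) (f g : int -> R)
    (e : int -> int) (M : R) :
  0 < M -> bijective e -> (forall j, 0 <= f j) ->
  (forall j, M * f j <= g (e j)) -> ell_mem p f -> ell_mem p g ->
  M * ell_norm p f <= ell_norm p g.
Proof.
move=> M0 be f0 fg fl gl; have [e' eK e'K] := be.
have Mf0 j : 0 <= M * f j by rewrite mulr_ge0 ?f0// ltW.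
have le1 : ell_norm p (fun j => M * f j) <= ell_norm p g.
  rewrite -(@ell_norm_reindex _ _ _ e'); last by exists e.
  by apply: ell_norm_le gl => j /=; rewrite Mf0 -{2}(e'K j) fg.
apply: le_trans le1; rewrite -ler_pdivlMl//.
have Mfl := ell_memZ (ltW M0) f0 fl.
have Mi0 : 0 <= M^-1 by rewrite invr_ge0 ltW.
apply: le_trans (ell_normZ Mi0 Mf0 Mfl).
apply: ell_norm_le (ell_memZ Mi0 Mf0 Mfl) => j.
by rewrite f0 mulKf ?gt_eqF/=.
Qed.

(** * Removing the weights *)

Lemma weight_potential (R : realType) (s : scalar_kind)
    (w : int -> scalars R s) :
  (forall j, w j != 0) ->
  exists W : int -> R,
    (forall j, 0 < W j) /\ forall j, W (j + 1) = modulus (w j) * W j.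
Proof.
move=> hw.
pose N n : R := \prod_(i < n) modulus (w (- i.+1%:Z)).
have N0 n : 0 < N n by apply: prodr_gt0 => i _; exact: modulus_gt0.
exists (fun j => match j with
  | Posz n => \prod_(i < n) modulus (w i%:Z) | Negz n => (N n.+1)^-1 end).
split=> [[n|n]|[n|[|n]]].
- by apply: prodr_gt0 => i _; exact: modulus_gt0.
- by rewrite invr_gt0.
- by rewrite -PoszD addn1 big_ord_recr/= mulrC.
- rewrite (_ : Negz 0 + 1 = Posz 0)// big_ord0 /N big_ord_recl big_ord0 mulr1.
  by rewrite NegzE mulfV// gt_eqF// modulus_gt0.
rewrite (_ : Negz n.+1 + 1 = Negz n); last first.
  by rewrite !NegzE [in LHS]intS opprD addrC addrA subrr add0r.
rewrite [in RHS]/N big_ord_recr/= -/(N n.+1) NegzE.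
by rewrite invfM mulrCA mulfV ?mulr1// gt_eqF// modulus_gt0.
Qed.

Lemma potential_prod (R : realType) (s : scalar_kind)
    (w : int -> scalars R s) (W : int -> R) :
  (forall j, W (j + 1) = modulus (w j) * W j) ->
  forall n j, W (j + n%:Z) = modulus (\prod_(i < n) w (j + i%:Z)) * W j.
Proof.
move=> hW; elim=> [|n IH] j.
  by rewrite big_ord0 addr0 modulus1 mul1r.
by rewrite big_ord_recr/= modulusM mulrAC -IH -addn1 PoszD addrA hW mulrC.
Qed.

Definition weighted_matrix (R : realType) (A : kothe_matrix R) (W : int -> R)
    (W0 : forall j, 0 < W j) : kothe_matrix R.
Proof.
apply: (@KotheMatrix R (fun j k => A j k * W j)) => [j k|j k|j].
- by rewrite mulr_ge0 ?kothe_entry_ge0// ltW.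
- by rewrite ler_pM2r// kothe_entry_nondecreasing.
- by have [k Ak] := kothe_entry_pos A j; exists k; rewrite mulr_gt0.
Defined.

Lemma ereal_inf_cvgy (R : realType) (D : set int) (r : nat -> int -> R) :
  ereal_inf [set (r n j)%:E | j in D] @[n --> \oo] --> +oo%E <->
  forall M : R, \forall n \near \oo, forall j, D j -> M <= r n j.
Proof.
split=> [/cvgeyPge h M|h].
  have := h M; apply: filterS => n hn j Dj; rewrite -lee_fin.
  by apply: (le_trans hn); apply: ereal_inf_lbound; exists j.
apply/cvgeyPge => M; have := h M; apply: filterS => n hn.
by apply: le_ereal_inf_tmp => _ [j Dj <-]; rewrite lee_fin hn.
Qed.

Lemma forward_ratio_cvgy (R : realType) (s : scalar_kind) (A : kothe_matrix R)
    (w : int -> scalars R s) (W : int -> R) (W0 : forall j, 0 < W j)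
    (S : set int) (k l : nat) :
  (forall j, W (j + 1) = modulus (w j) * W j) ->
  ereal_inf [set (forward_ratio A w k l n j)%:E
            | j in index_support A k `&` S] @[n --> \oo] --> +oo%E <->
  blows_up (weighted_matrix A W0) S k l.
Proof.
move=> hW; rewrite ereal_inf_cvgy.
have E M n j : A j k != 0 -> (M <= forward_ratio A w k l n j) =
    (M * weighted_matrix A W0 j k <= weighted_matrix A W0 (j + n%:Z) l).
  move=> Aj; have Aj0 : 0 < A j k by rewrite lt_def Aj kothe_entry_ge0.
  rewrite /= /forward_ratio ler_pdivlMr// (potential_prod hW) !mulrA.
  by rewrite ler_pM2r.
split=> h M; have := h M; apply: filterS => n {}h j.
  move=> Sj; have [Aj|Aj] := eqVneq (A j k) 0; last by rewrite -E//; exact: h.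
  by rewrite /= Aj mul0r mulr0 mulr_ge0 ?kothe_entry_ge0 ?ltW.
by move=> [Aj Sj]; rewrite E//; exact: h.
Qed.

Lemma blows_up_reflect (R : realType) (B : kothe_matrix R) (S : set int)
    (k l : nat) :
  blows_up (reflect_matrix B) [set j | S (- j)] k l <->
  forall M : R, \forall n \near \oo, forall j, S j ->
    M * B j k <= B (j - n%:Z) l.
Proof.
split=> h M; have := h M; apply: filterS => n {}h j Sj.
  by have := h (- j); rewrite /= opprD !opprK; exact.
by rewrite /= opprD; exact: h.
Qed.

Lemma backward_ratio_cvgy (R : realType) (s : scalar_kind) (A : kothe_matrix R)
    (w : int -> scalars R s) (W : int -> R) (W0 : forall j, 0 < W j)
    (S : set int) (k l : nat) :
  (forall j, w j != 0) -> (forall j, W (j + 1) = modulus (w j) * W j) ->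
  ereal_inf [set (backward_ratio A w k l n j)%:E
            | j in index_support A k `&` S] @[n --> \oo] --> +oo%E <->
  blows_up (reflect_matrix (weighted_matrix A W0)) [set j | S (- j)] k l.
Proof.
move=> hw hW; rewrite ereal_inf_cvgy blows_up_reflect.
have E M n j : A j k != 0 -> (M <= backward_ratio A w k l n j) =
    (M * weighted_matrix A W0 j k <= weighted_matrix A W0 (j - n%:Z) l).
  move=> Aj; have Aj0 : 0 < A j k by rewrite lt_def Aj kothe_entry_ge0.
  have := potential_prod hW n (j - n%:Z); rewrite subrK => Wj.
  rewrite /= /backward_ratio ler_pdivlMr; last first.
    rewrite mulr_gt0// modulus_gt0//; apply/prodf_neq0 => i _; exact: hw.
  by rewrite Wj !mulrA ler_pM2r.
split=> h M; have := h M; apply: filterS => n {}h j.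
  move=> Sj; have [Aj|Aj] := eqVneq (A j k) 0; last by rewrite -E//; exact: h.
  by rewrite /= Aj mul0r mulr0 mulr_ge0 ?kothe_entry_ge0 ?ltW.
by move=> [Aj Sj]; rewrite E//; exact: h.
Qed.

(** * Uniform expansivity as growth of entries *)

(** When A i k = 0 this is the zero vector: its i-th coordinate is then
    the inverse of 0. *)
Lemma kothe_unit_vector (R : realType) (s : scalar_kind) (A : kothe_matrix R)
    (p : exponent R) (k : nat) (i : int) :
  exists x : kothe_space s A p,
    modulus (kothe_val x i) = (A i k)^-1 /\
    forall j, j != i -> modulus (kothe_val x j) = 0.
Proof.
have [c cE] : exists c : scalars R s, modulus c = (A i k)^-1.
  by apply: modulus_surj; rewrite invr_ge0 kothe_entry_ge0.
pose f j : (scalars R s)^o := if j == i then c else 0.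
have fP : f \in kothe_pred s A p.
  rewrite inE => m; apply: (@ell_mem_point _ _ _ i) => j /negbTE ji.
  by rewrite /f ji modulus0 mulr0.
exists (KotheSpace fP); split=> [|j /negbTE ji] /=; first by rewrite /f eqxx.
by rewrite /f ji modulus0.
Qed.

(** The n-th operator moves coordinate j to coordinate e n j and multiplies its
    modulus by W (e n j) / W j; the iterates of the shift and those of its
    inverse are both of this kind, and are treated together. *)
Definition transports (R : realType) (s : scalar_kind) (A : kothe_matrix R)
    (p : exponent R) (W : int -> R)
    (U : nat -> kothe_space s A p -> kothe_space s A p)
    (e : nat -> int -> int) : Prop :=
  forall n, bijective (e n) /\ forall x j,
    modulus (kothe_val (U n x) (e n j)) * W j =
    W (e n j) * modulus (kothe_val x j).

Lemma kothe_coord_ge0 (R : realType) (s : scalar_kind) (A : kothe_matrix R)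
    (p : exponent R) (k : nat) (x : kothe_space s A p) (j : int) :
  0 <= A j k * modulus (kothe_val x j).
Proof. by rewrite mulr_ge0 ?kothe_entry_ge0 ?modulus_ge0. Qed.

Lemma kothe_coord_mem (R : realType) (s : scalar_kind) (A : kothe_matrix R)
    (p : exponent R) (k : nat) (x : kothe_space s A p) :
  ell_mem p (fun j => A j k * modulus (kothe_val x j)).
Proof. by have := kothe_valP x; rewrite inE; exact. Qed.

(** Only the coordinates in S are known to grow, whence the lower bound on the
    part of x carried by S; the constant 1/2 is the share that one of two
    complementary parts of a unit vector must have. *)
Lemma blows_up_diverges (R : realType) (s : scalar_kind) (A : kothe_matrix R)
    (p : exponent R) (W : int -> R) (W0 : forall j, 0 < W j)
    (U : nat -> kothe_space s A p -> kothe_space s A p)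
    (e : nat -> int -> int) (S : set int) (k l : nat) :
  transports W U e ->
  (forall M : R, \forall n \near \oo, forall j, S j ->
    M * weighted_matrix A W0 j k <= weighted_matrix A W0 (e n j) l) ->
  diverges_uniformly_on
    [set x | 2^-1 <= ell_norm p
      (fun j => \1_S j * (A j k * modulus (kothe_val x j)))]
    (fun n x => kothe_seminorm l (U n x)).
Proof.
move=> tr bS M; have [M0|M0] := leP M 0.
  by apply: nearW => n x _; exact: le_trans M0 (kothe_seminorm_ge0 _ _).
have M20 : 0 < M * 2 by rewrite mulr_gt0.
have := bS (M * 2); apply: filterS => n h x /= x2.
have [be trn] := tr n.
have -> : M = M * 2 * 2^-1 by rewrite mulfK.
apply: (le_trans (ler_wpM2l (ltW M20) x2)).
have f0 j : 0 <= \1_S j * (A j k * modulus (kothe_val x j)).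
  by rewrite mulr_ge0 ?kothe_coord_ge0// indicE.
apply: (ler_ell_norm_moved M20 be f0); last 2 first.
- apply: ell_mem_le (kothe_coord_mem k x) => j; rewrite f0/=.
  by rewrite ler_piMl ?kothe_coord_ge0// indicE; case: (j \in S).
- exact: kothe_coord_mem.
move=> j; rewrite indicE.
case: (boolP (j \in S)) => [/set_mem Sj|_]; last first.
  by rewrite mul0r mulr0 kothe_coord_ge0.
rewrite mul1r -(ler_pM2r (W0 j)) -[leRHS]mulrA trn mulrA.
have := ler_wpM2r (modulus_ge0 (kothe_val x j)) (h j Sj).
by rewrite /= !mulrA; congr (_ <= _); rewrite mulrAC.
Qed.

(** Tested on the normalized unit vector d j, the seminorm of the image reduces
    to its single nonzero coordinate, at e n j. *)
Lemma diverges_blows_up (R : realType) (s : scalar_kind)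
    (A : kothe_matrix R) (p : exponent R) (W : int -> R)
    (W0 : forall j, 0 < W j)
    (U : nat -> kothe_space s A p -> kothe_space s A p)
    (e : nat -> int -> int) (V : set (kothe_space s A p))
    (d : int -> kothe_space s A p) (k l : nat) :
  transports W U e ->
  (forall i, modulus (kothe_val (d i) i) = (A i k)^-1 /\
    forall j, j != i -> modulus (kothe_val (d i) j) = 0) ->
  diverges_uniformly_on V (fun n x => kothe_seminorm l (U n x)) ->
  forall M : R, \forall n \near \oo, forall j, A j k = 0 \/ V (d j) ->
    M * weighted_matrix A W0 j k <= weighted_matrix A W0 (e n j) l.
Proof.
move=> tr dE dV M; have := dV M; apply: filterS => n h j.
have [be trn] := tr n; have [e' eK e'K] := be; have [di dj] := dE j.
have [Aj _|Aj [/eqP|/h]] := eqVneq (A j k) 0.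
- by rewrite /= Aj mul0r mulr0 mulr_ge0 ?kothe_entry_ge0 ?ltW.
- by rewrite (negbTE Aj).
have Aj0 : 0 < A j k by rewrite lt_def Aj kothe_entry_ge0.
rewrite /kothe_seminorm (@ell_norm_point _ _ _ (e n j)); last first.
  move=> i ij; have := trn (d j) (e' i); rewrite e'K dj ?mulr0; last first.
    by apply: contra_neq ij => <-; rewrite e'K.
  by move/eqP; rewrite mulf_eq0 (gt_eqF (W0 _)) orbF => /eqP ->; rewrite mulr0.
rewrite ger0_norm ?kothe_coord_ge0// => hM.
have := ler_wpM2r (ltW (W0 j)) hM; rewrite -[X in _ <= X -> _]mulrA trn di.
move=> /(ler_wpM2r (ltW Aj0)); rewrite /= !mulrA mulfVK//.
by rewrite mulrAC.
Qed.

Section shift_orbits.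
Variables (R : realType) (s : scalar_kind) (A : kothe_matrix R).
Variables (p : exponent R) (w : int -> scalars R s).
Variable Fw : invertible_operator (kothe_space s A p).
Hypothesis hFw : forall x : kothe_space s A p,
  kothe_val (Fw x) = weighted_shift w (kothe_val x).
Variable W : int -> R.
Hypothesis hW : forall j, W (j + 1) = modulus (w j) * W j.

Lemma shift_transports : transports W (fun n => iter n Fw)
  (fun n j => j + n%:Z).
Proof.
move=> n; split.
  by exists (fun j => j - n%:Z) => j; rewrite ?addrK ?subrK.
move=> x; elim: n => [|n IH] j; first by rewrite addr0 mulrC.
rewrite /= hFw /weighted_shift modulusM -addn1 PoszD addrA addrK hW.
by rewrite -!mulrA IH mulrCA.
Qed.

Lemma inverse_shift_transports : transports W (fun n => iter n (op_inv Fw))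
  (fun n j => j - n%:Z).
Proof.
move=> n; split.
  by exists (fun j => j + n%:Z) => j; rewrite ?addrK ?subrK.
move=> x j.
have nK y : iter n Fw (iter n (op_inv Fw) y) = y.
  elim: n y => // n IH y; rewrite iterSr /= op_invK; exact: IH.
have [_ /(_ (iter n (op_inv Fw) x) (j - n%:Z))] := shift_transports n.
rewrite nK subrK => E.
by rewrite mulrC -E mulrC.
Qed.

Hypothesis W0 : forall j, 0 < W j.

Lemma uniformly_expansive_splitting :
  uniformly_expansive (@kothe_seminorm R s A p) Fw <->
  growth_splitting (weighted_matrix A W0).
Proof.
split=> h k.
  have [d dE] := choice (kothe_unit_vector s A p k).
  have [l [Sp [Sm [cover dp dm]]]] := h k.
  exists l, [set j | A j k = 0 \/ Sp (d j)],
    [set j | A (- j) k = 0 \/ Sm (d (- j))]; split.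
  - move=> j /=; rewrite opprK; have [Aj|Aj] := eqVneq (A j k) 0.
      by left; left.
    suff : (Sp `|` Sm) (d j) by move=> [|]; [left; right|right; right].
    rewrite -cover /= /kothe_seminorm; have [di dj] := dE j.
    rewrite (@ell_norm_point _ _ _ j) => [|i /dj ->]; last exact: mulr0.
    by rewrite di mulfV// normr1.
  - exact: diverges_blows_up shift_transports dE dp.
  - apply/(blows_up_reflect _ [set j | A j k = 0 \/ Sm (d j)]).
    exact: diverges_blows_up inverse_shift_transports dE dm.
have [l [P [Q [PQ bP bQ]]]] := h k.
pose half (S : set int) := [set x : kothe_space s A p | 2^-1 <= ell_norm p
      (fun j => \1_S j * (A j k * modulus (kothe_val x j)))].
(* P and the reflection of Q may overlap; keeping only the complement of P
   makes x the sum of its parts carried by the two sets. *)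
have {}bQ : blows_up (reflect_matrix (weighted_matrix A W0))
    [set j | (~` P) (- j)] k l.
  apply: blows_upS bQ => // j /= nP.
  by have [//|] := PQ (- j); rewrite opprK.
have Dsub (S S' : set (kothe_space s A p)) f : S `<=` S' ->
    diverges_uniformly_on S' f -> diverges_uniformly_on S f.
  by move=> SS dS M; have := dS M; apply: filterS => n {}h x /SS; exact: h.
exists l, ([set x | kothe_seminorm k x = 1] `&` half P),
  ([set x | kothe_seminorm k x = 1] `&` half (~` P)); split.
- have half_le (a b : R) : 1 <= a + b -> 2^-1 <= a \/ 2^-1 <= b.
    case: (leP 2^-1 a) => [|a2]; first by left.
    case: (leP 2^-1 b) => [|b2]; first by right.
    by rewrite leNgt [X in _ < X](splitr 1) !div1r ltrD.
  rewrite -setIUr; apply/esym/setIidPl => x /= x1.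
  suff : 1 <= ell_norm p (fun j => \1_P j * (A j k * modulus (kothe_val x j)))
      + ell_norm p (fun j => \1_(~` P) j * (A j k * modulus (kothe_val x j))).
    exact: half_le.
  have f0 (S : set int) j : 0 <= \1_S j * (A j k * modulus (kothe_val x j)).
    by rewrite mulr_ge0 ?kothe_coord_ge0// indicE.
  have fl (S : set int) :
      ell_mem p (fun j => \1_S j * (A j k * modulus (kothe_val x j))).
    apply: ell_mem_le (kothe_coord_mem k x) => j; rewrite f0/=.
    by rewrite ler_piMl ?kothe_coord_ge0// indicE; case: (j \in S).
  apply: le_trans (ell_normD (f0 P) (f0 (~` P)) (fl P) (fl (~` P))).
  rewrite -[X in X <= _]x1 /kothe_seminorm le_eqVlt; apply/orP; left; apply/eqP.
  congr ell_norm; apply/funext => j; rewrite -mulrDl !indicE in_setC.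
  by case: (j \in P); rewrite ?addr0 ?add0r mul1r.
- apply: Dsub; last exact: blows_up_diverges shift_transports bP.
  by move=> x [].
- apply: Dsub; last first.
    apply: blows_up_diverges inverse_shift_transports _.
    by apply/blows_up_reflect; exact: bQ.
  by move=> x [].
Qed.

End shift_orbits.

Theorem theorem11 (R : realType) (s : scalar_kind) (A : kothe_matrix R)
    (p : exponent R) (w : int -> scalars R s) (hw : forall j : int, w j != 0)
    (Fw : invertible_operator (kothe_space s A p))
    (hFw : forall x : kothe_space s A p,
      kothe_val (Fw x) = weighted_shift w (kothe_val x)) :
  uniformly_expansive (@kothe_seminorm R s A p) Fw <->
  [\/ forall k : nat, exists l : nat,
        ereal_inf [set (forward_ratio A w k l n j)%:E
                  | j in index_support A k] @[n --> \oo] --> +oo%E,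
      forall k : nat, exists l : nat,
        ereal_inf [set (backward_ratio A w k l n j)%:E
                  | j in index_support A k] @[n --> \oo] --> +oo%E
    | forall k : nat, exists l : nat,
        ereal_inf [set (forward_ratio A w k l n j)%:E
                  | j in index_support A k `&` [set j : int | 0 < j]]
          @[n --> \oo] --> +oo%E /\
        ereal_inf [set (backward_ratio A w k l n j)%:E
                  | j in index_support A k `&` [set j : int | j < 0]]
          @[n --> \oo] --> +oo%E].
Proof.
have [W [W0 hW]] := weight_potential hw.
rewrite (uniformly_expansive_splitting hFw hW W0) growth_splittingP.
have F S k l := forward_ratio_cvgy A W0 S k l hW.
have G S k l := backward_ratio_cvgy A W0 S k l hw hW.
have FT k l := F setT k l; have GT k l := G setT k l.
have GN k l := G [set j | j < 0] k l.
have NE : [set j : int | [set i : int | i < 0] (- j)] = [set j | 0 < j].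
  by apply/seteqP; split=> j /=; rewrite oppr_lt0.
rewrite NE in GN.
have TE : [set j : int | [set: int] (- j)] = setT by apply/seteqP.
rewrite TE in GT.
have IE k : index_support A k `&` setT = index_support A k := setIT _.
split=> [[h|h|h]|[h|h|h]].
- by constructor 1 => k; have [l /FT] := h k; rewrite IE; exists l.
- by constructor 2 => k; have [l /GT] := h k; rewrite IE; exists l.
- by constructor 3 => k; have [l [/F ? /GN ?]] := h k; exists l.
- by constructor 1 => k; have [l hl] := h k; exists l; apply/FT; rewrite IE.
- by constructor 2 => k; have [l hl] := h k; exists l; apply/GT; rewrite IE.
- by constructor 3 => k; have [l [/F ? /GN ?]] := h k; exists l.
Qed.
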